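(* Let $r,k\in\mathbb Z$, $0\le k\le r$. Let $u$ be the exact solution of the initial value problem $Mu'=F(\cdot,u)$, $u(t_0)=u_0$, let $\widetilde U$ be the solution of the collocation method with respect to the quadrature points of $Q^r_k$, and suppose that the error estimate $$\max_{1\le n\le N}\big\|(u-\widetilde U)(t_n^-)\big\|\le C(F,u)\,\tau^{2r-k+1}$$ holds. Then $$\max_{1\le n\le N}\big\|(u-U)(t_n^-)\big\|=\max_{1\le n\le N}\big\|(u-\widetilde U)(t_n^-)\big\|\le C(F,u)\,\tau^{2r-k+1}$$ for the solution $U$ of $Q^r_k\text{-}\mathbf{VTD}^r_k$.
   Context: Problem: $M u'(t)=F(t,u(t))$, $u(t_0)=u_0\in\mathbb R^d$, on $I=(t_0,t_0+T]$, $T>0$, with $M\in\mathbb R^{d\times d}$ regular; $F$ is sufficiently smooth (all derivatives of $F$ and of $u$ that occur exist and are continuous) and Lipschitz continuous in its second variable. $C(F,u)$ denotes a generic constant depending on $F,u$ (and on fixed data such as $r,k,T$) but independent of the time mesh parameter $\tau$; estimates are for all time meshes under consideration. ''The solution'' presupposes that the discrete solutions exist and are unique. Notation: mesh $t_0<t_1<\dots<t_N=t_0+T$, $I_n=(t_{n-1},t_n]$, $\tau_n=t_n-t_{n-1}$, $\tau=\max_n\tau_n$. $(\cdot,\cdot)$, $\|\cdot\|$ are the Euclidean inner product and norm on $\mathbb R^d$. $P_s(J,\mathbb R^q)$ is the space of $\mathbb R^q$-valued polynomials on $J$ of degree $\le s$. $Y_s$ is the space of functions $\varphi\in L^2(I,\mathbb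 R^d)$ with $\varphi|_{I_n}\in P_s(I_n,\mathbb R^d)$ for all $n$. $v(t_n^\pm)$ are one-sided limits, $[v]_n=v(t_n^+)-v(t_n^-)$. $\delta_{i,j}$ is the Kronecker delta. Interpolation and quadrature: for $0\le k\le r$ let $\widehat{\mathcal I}^r_k:C^{\lfloor k/2\rfloor}([-1,1])\to P_r([-1,1])$ be the Hermite interpolation operator preserving derivatives of orders $0,\dots,\lfloor\frac{k-1}{2}\rfloor$ at $-1$ (none if $k=0$), derivatives of orders $0,\dots,\lfloor\frac k2\rfloor$ at $+1$, and the function values at the zeros $\hat t_1,\dots,\hat t_{r-k}\in(-1,1)$ of the $(r-k)$th Jacobi polynomial with respect to the weight $(1+\hat t)^{\lfloor\frac{k-1}{2}\rfloor+1}(1-\hat t)^{\lfloor\frac k2\rfloor+1}$. Let $\widehat Q^r_k[\hat f]=\int_{-1}^1\widehat{\mathcal I}^r_k\hat f\,\mathrm d\hat t$; $\mathcal I^r_k$ and $Q^r_k$ denote their affine transformations to $I_n$ (so $Q^r_k[\varphi]=\int_{I_n}\mathcal I^r_k\varphi\,\mathrm dt$), and $t_{n,i}=\frac12(t_{n-1}+t_n+\tau_n\hat t_i)$, $i=1,\dots,r-k$. Collocation method with respect to the quadrature points of $Q^r_k$: $\widetilde U\in Y_{r+1}$ with $\widetilde U(t_0^-)=u_0$ such that for all $n=1,\dots,N$: $\widetilde U(t_{n-1}^+)=\widetilde U(t_{n-1}^-)$; $M\widetilde U^{(i+1)}(t_n^-)=\frac{\mathrm d^i}{\mathrm dt^i}(F(t,\widetilde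 U(t)))|_{t=t_n^-}$ for $i=0,\dots,\lfloor\frac k2\rfloor$; if $k\ge1$, $M\widetilde U^{(i+1)}(t_{n-1}^+)=\frac{\mathrm d^i}{\mathrm dt^i}(F(t,\widetilde U(t)))|_{t=t_{n-1}^+}$ for $i=0,\dots,\lfloor\frac{k-1}2\rfloor$; and $M\widetilde U'(t_{n,i})=F(t_{n,i},\widetilde U(t_{n,i}))$ for $i=1,\dots,r-k$. Method $Q^r_k\text{-}\mathbf{VTD}^r_k$: $U\in Y_r$ with $U(t_0^-)=u_0$ such that for every $n=1,\dots,N$: (1) if $k\ge1$: $U(t_{n-1}^+)=U(t_{n-1}^-)$; (2) if $k\ge2$: $M U^{(i+1)}(t_n^-)=\frac{\mathrm d^i}{\mathrm dt^i}\big(F(t,U(t))\big)\big|_{t=t_n^-}$ for $i=0,\dots,\lfloor\frac k2\rfloor-1$; (3) if $k\ge3$: $M U^{(i+1)}(t_{n-1}^+)=\frac{\mathrm d^i}{\mathrm dt^i}\big(F(t,U(t))\big)\big|_{t=t_{n-1}^+}$ for $i=0,\dots,\lfloor\frac{k-1}2\rfloor-1$; (4) $Q^r_k\big[(MU',\varphi)\big]+\delta_{0,k}\big(M[U]_{n-1},\varphi(t_{n-1}^+)\big)=Q^r_k\big[(F(\cdot,U(\cdot)),\varphi)\big]$ for all $\varphi\in P_{r-k}(I_n,\mathbb R^d)$. *)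

(* Defs.v *)
From HB Require Import structures.
From mathcomp Require Import all_boot all_order all_algebra.
From mathcomp Require Import all_classical all_reals all_analysis.

Set Implicit Arguments.
Unset Strict Implicit.
Unset Printing Implicit Defensive.

Import Order.TTheory GRing.Theory Num.Theory.
Import numFieldNormedType.Exports.

Local Open Scope classical_set_scope.
Local Open Scope ring_scope.

(* The canonical norm `|x| on 'cV[R]_d is the max norm, hence [enorm]. *)
Definition dotp (R : realType) (d : nat) (x y : 'cV[R]_d) : R :=
  \sum_(i < d) x i ord0 * y i ord0.

Definition enorm (R : realType) (d : nat) (x : 'cV[R]_d) : R :=
  Num.sqrt (dotp x x).

(* f^(j)(t-) and f^(j)(t+), as one-sided limits of the ordinary j-th
   derivative; for j = 0 these are f(t-) and f(t+). *)
Definition lderiv (R : realType) (V : normedModType R) (j : nat)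
    (f : R -> V) (t : R) : V :=
  lim (derive1n j f x @[x --> t^'-]).

Definition rderiv (R : realType) (V : normedModType R) (j : nat)
    (f : R -> V) (t : R) : V :=
  lim (derive1n j f x @[x --> t^'+]).

(* G is of class C^m on the closed strip [a, b] x R^d: its derivatives of order
   <= m exist on the open strip and extend continuously to the closed one. *)
Fixpoint Cstrip (R : realType) (d : nat) (a b : R) (m : nat)
    (G : R * 'cV[R]_d -> 'cV[R]_d) : Prop :=
  {within [set z | a <= z.1 <= b], continuous G} /\
  match m with
  | 0%N => True
  | m'.+1 =>
      (forall z : R * 'cV[R]_d, a < z.1 < b -> differentiable G z) /\
      (forall v : R * 'cV[R]_d,
        exists2 H : R * 'cV[R]_d -> 'cV[R]_d, Cstrip a b m' H &
          forall z : R * 'cV[R]_d, a < z.1 < b -> 'D_v G z = H z)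
  end.

Definition lipschitz2 (R : realType) (d : nat) (a b : R)
    (F : R -> 'cV[R]_d -> 'cV[R]_d) : Prop :=
  exists L : R, forall t, a <= t <= b ->
    forall x y, enorm (F t x - F t y) <= L * enorm (x - y).

(* The derivative is taken relative to (t0, t0 + T]: it is two-sided except at
   the right end point. *)
Definition solves_ivp (R : realType) (d : nat) (M : 'M[R]_d)
    (F : R -> 'cV[R]_d -> 'cV[R]_d) (t0 T : R) (u0 : 'cV[R]_d)
    (u : R -> 'cV[R]_d) : Prop :=
  [/\ u t0 = u0,
      {within `[t0, t0 + T], continuous u} &
      forall t, t \in `]t0, t0 + T] ->
        exists2 v : 'cV[R]_d,
          (s - t)^-1 *: (u s - u t) @[s --> within `]t0, t0 + T] t^'] --> v &
          M *m v = F t (u t)].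

(* Only the values [mt n] with n <= mN are meaningful. *)
Record mesh (R : realType) (t0 T : R) := Mesh {
  mN : nat;
  mt : nat -> R;
  _ : mt 0%N = t0;
  _ : mt mN = t0 + T;
  _ : forall n, (n < mN)%N -> mt n < mt n.+1
}.

Definition msize (R : realType) (t0 T : R) (m : mesh t0 T) : R :=
  \big[Num.max/0]_(n < mN m) (mt m n.+1 - mt m n).

Definition polyfun (R : realType) (d s : nat) (J : interval R)
    (f : R -> 'cV[R]_d) : Prop :=
  exists2 p : 'I_d -> {poly R},
    (forall i, size (p i) <= s.+1)%N &
    forall t, t \in J -> forall i, f t i ord0 = (p i).[t].

(* Piecewise polynomials are automatically square integrable.  The values
   outside (t0, t0 + T] are irrelevant. *)
Definition Yspace (R : realType) (d s : nat) (t0 T : R) (m : mesh t0 T)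
    (V : R -> 'cV[R]_d) : Prop :=
  forall n, (n < mN m)%N -> polyfun s `]mt m n, mt m n.+1] V.

(* V(t_n^-), with the convention V(t_0^-) = u0. *)
Definition lvalue (R : realType) (d : nat) (u0 : 'cV[R]_d) (t0 T : R)
    (m : mesh t0 T) (V : R -> 'cV[R]_d) (n : nat) : 'cV[R]_d :=
  if n is 0%N then u0 else lderiv 0 V (mt m n).

(* A polynomial of degree n orthogonal to all polynomials of lower degree is
   the n-th Jacobi polynomial up to a nonzero factor. *)
Definition is_jacobi (R : realType) (a b n : nat) (p : {poly R}) : Prop :=
  size p = n.+1 /\
  forall q : {poly R}, (size q <= n)%N ->
    \int[lebesgue_measure]_(x in `[(-1 : R), 1])
       ((1 + x) ^+ a * (1 - x) ^+ b * p.[x] * q.[x]) = 0.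

Definition jacobi_zeros (R : realType) (a b n : nat) (th : 'I_n -> R) : Prop :=
  [/\ injective th,
      forall i, -1 < th i < 1 &
      exists2 p, is_jacobi a b n p &
        forall x, root p x <-> exists i, x = th i].

(* [uphalf k] is floor((k-1)/2) + 1, including 0 for k = 0. *)
Definition quad_nodes (R : realType) (r k : nat) (th : 'I_(r - k) -> R) : Prop :=
  jacobi_zeros (uphalf k) (k./2.+1) th.

Definition is_hermite (R : realType) (r k : nat) (th : 'I_(r - k) -> R)
    (f : R -> R) (p : {poly R}) : Prop :=
  [/\ (size p <= r.+1)%N,
      forall j, (j < uphalf k)%N -> p^`(j).[-1] = rderiv j f (-1),
      forall j, (j <= k./2)%N -> p^`(j).[1] = lderiv j f 1 &
      forall i, p.[th i] = f (th i)].

Definition hermite (R : realType) (r k : nat) (th : 'I_(r - k) -> R)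
    (f : R -> R) : {poly R} :=
  xget 0 [set p | is_hermite th f p].

Definition to_cell (R : realType) (a b x : R) : R := (a + b + (b - a) * x) / 2.

Definition interp (R : realType) (r k : nat) (th : 'I_(r - k) -> R) (a b : R)
    (f : R -> R) : {poly R} :=
  hermite th (f \o to_cell a b)
    \Po ((2 / (b - a)) *: 'X - ((a + b) / (b - a))%:P).

Definition quad (R : realType) (r k : nat) (th : 'I_(r - k) -> R) (a b : R)
    (f : R -> R) : R :=
  \int[lebesgue_measure]_(t in `]a, b]) (interp th a b f).[t].

Record is_collocation (R : realType) (d r k : nat) (th : 'I_(r - k) -> R)
    (M : 'M[R]_d) (F : R -> 'cV[R]_d -> 'cV[R]_d) (u0 : 'cV[R]_d) (t0 T : R)
    (m : mesh t0 T) (V : R -> 'cV[R]_d) : Prop := IsCollocation {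
  col_space : Yspace r.+1 m V;
  col_cont : forall n, (n < mN m)%N ->
    rderiv 0 V (mt m n) = lvalue u0 m V n;
  col_right : forall n, (n < mN m)%N -> forall i, (i <= k./2)%N ->
    M *m lderiv i.+1 V (mt m n.+1) =
    lderiv i (fun t => F t (V t)) (mt m n.+1);
  col_left : forall n, (n < mN m)%N -> forall i, (i < uphalf k)%N ->
    M *m rderiv i.+1 V (mt m n) =
    rderiv i (fun t => F t (V t)) (mt m n);
  col_inner : forall n, (n < mN m)%N -> forall i : 'I_(r - k),
    let t := to_cell (mt m n) (mt m n.+1) (th i) in
    M *m derive1 V t = F t (V t)
}.

Record is_VTD (R : realType) (d r k : nat) (th : 'I_(r - k) -> R)
    (M : 'M[R]_d) (F : R -> 'cV[R]_d -> 'cV[R]_d) (u0 : 'cV[R]_d) (t0 T : R)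
    (m : mesh t0 T) (V : R -> 'cV[R]_d) : Prop := IsVTD {
  vtd_space : Yspace r m V;
  vtd_cont : (1 <= k)%N -> forall n, (n < mN m)%N ->
    rderiv 0 V (mt m n) = lvalue u0 m V n;
  vtd_right : forall n, (n < mN m)%N -> forall i, (i < k./2)%N ->
    M *m lderiv i.+1 V (mt m n.+1) =
    lderiv i (fun t => F t (V t)) (mt m n.+1);
  vtd_left : forall n, (n < mN m)%N -> forall i, (i.+1 < uphalf k)%N ->
    M *m rderiv i.+1 V (mt m n) =
    rderiv i (fun t => F t (V t)) (mt m n);
  vtd_var : forall n, (n < mN m)%N -> forall phi : R -> 'cV[R]_d,
    polyfun (r - k) `]mt m n, mt m n.+1] phi ->
    quad th (mt m n) (mt m n.+1) (fun t => dotp (M *m derive1 V t) (phi t))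
    + (k == 0%N)%:R
      * dotp (M *m (rderiv 0 V (mt m n) - lvalue u0 m V n))
             (rderiv 0 phi (mt m n))
    = quad th (mt m n) (mt m n.+1) (fun t => dotp (F t (V t)) (phi t))
}.

Definition is_the_solution (R : realType) (d : nat) (t0 T : R)
    (P : (R -> 'cV[R]_d) -> Prop) (V : R -> 'cV[R]_d) : Prop :=
  P V /\ forall W, P W -> {in `]t0, t0 + T], W =1 V}.

(* max_{1 <= n <= N} |(u - V)(t_n^-)| *)
Definition nodal_error (R : realType) (d : nat) (t0 T : R) (m : mesh t0 T)
    (u V : R -> 'cV[R]_d) : R :=
  \big[Num.max/0]_(n < mN m) enorm (lderiv 0 (u \- V) (mt m n.+1)).

(* Main.v *)
Require Import Defs.
From HB Require Import structures.
From mathcomp Require Import all_boot all_order all_algebra.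
From mathcomp Require Import all_classical all_reals all_analysis.
From mathcomp Require Import ring lra zify.

Set Implicit Arguments.
Unset Strict Implicit.
Unset Printing Implicit Defensive.

Import Order.TTheory GRing.Theory Num.Theory.
Import numFieldNormedType.Exports.

Local Open Scope classical_set_scope.
Local Open Scope ring_scope.

(** The theorem holds because the two methods are linked by interpolation.
Let [V] be the collocation solution and let [W] be, on every cell, the Hermite
interpolant of [V] at the points of the quadrature rule.  It suffices to show
that [W] solves the variational method: then [U = W] by uniqueness, and since
the right end point of a cell is an interpolation point, [W] and [V] have the
same values [W(t_n^-) = V(t_n^-)], hence the same nodal errors.

On a cell [(a, b]] the interpolant has a closed form.  The polynomial
[w = (X-a)^p (X-b)^q prod (X - t_i)], with [p = floor((k-1)/2) + 1] and
[q = floor(k/2) + 1], is monic of degree [r+1] and has vanishing interpolation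
data, so [W = V - w c] where [c] is the coefficient of [X^(r+1)] in [V]
([interpolant]).  Three facts then give the equations of the method.

- The right-hand sides [F(t, W(t))] and [F(t, V(t))] have the same
  interpolation data, since by the chain rule a derivative of [F(t, W(t))] at an
  end point only involves derivatives of [W] of at most the same order
  ([same_jet_Cstrip]).  By the collocation conditions these are also the data of
  the polynomial [M V'] ([same_jet_rhs]); this yields the point conditions
  ([lim_vtd_condition]) and the right-hand side of the variational condition.

- The quadrature rule is exact up to degree [2r-k] ([quad_exact]): the
  interpolation error of a polynomial is a multiple [w g], and [w] is the Jacobi
  weight times the Jacobi polynomial, so it is orthogonal to all polynomials of
  degree less than [r-k] ([node_poly_orthogonal]).  Hence both sides of the
  variational condition, tested with [phi], are integrals of polynomials.

- These integrals differ by [M c] tested with the integral of [w' phi].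
  Integrating by parts, orthogonality removes the integral of [w phi'], and
  [w(b) = 0], so only [-w(a) phi(a)] is left.  It vanishes for [k >= 1], and for
  [k = 0] it is exactly compensated by the jump term, because the jump of [W] at
  [a] is [-w(a) c] ([cell_vtd_var]). *)

(** * Integrals of polynomials over a cell *)

Section Integral.
Variable R : realType.
Implicit Types (a b c : R) (p q : {poly R}).

Definition polyint a b p : R := \int[lebesgue_measure]_(t in `]a, b]) p.[t].

(** With antiderivatives and [polyint_deriv], every identity between integrals
    below becomes an algebraic identity between polynomials. *)
Lemma antiderivative p : exists P, P^`() = p.
Proof.
exists (\poly_(i < (size p).+1) (p`_i.-1 / i%:R)); apply/polyP => i.
rewrite coef_deriv coef_poly ltnS /=.
case: ltnP => [_|h]; last by rewrite mul0rn nth_default.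
by rewrite -[LHS]mulr_natr divfK // pnatr_eq0.
Qed.

Lemma Rintegral_deriv_cc a b p : a < b ->
  \int[lebesgue_measure]_(t in `[a, b]) (p^`()).[t] = p.[b] - p.[a].
Proof.
move=> ab; rewrite /Rintegral (@continuous_FTC2 _ (horner p^`()) (horner p)) //.
- by apply: continuous_subspaceT => x; exact: continuous_horner.
- split; first by move=> x _; exact: derivable_horner.
    by apply: cvg_at_right_filter; exact: continuous_horner.
  by apply: cvg_at_left_filter; exact: continuous_horner.
- by move=> x _; rewrite derivE.
Qed.

Lemma polyint_deriv a b p : a < b -> polyint a b p^`() = p.[b] - p.[a].
Proof.
move=> ab; rewrite -Rintegral_deriv_cc // /polyint.
apply: Rintegral_itv_obnd_cbnd.
have ip : lebesgue_measure.-integrable `[a, b] (EFin \o horner p^`()).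
  apply: continuous_compact_integrable; first exact: segment_compact.
  by apply: continuous_subspaceT => x; exact: continuous_horner.
by apply: integrableS ip => //; apply: subset_itvr; rewrite bnd_simp.
Qed.

Lemma polyintD a b p q : a < b ->
  polyint a b (p + q) = polyint a b p + polyint a b q.
Proof.
move=> ab; have [P <-] := antiderivative p; have [Q <-] := antiderivative q.
by rewrite -derivD !polyint_deriv // !hornerD opprD addrACA.
Qed.

Lemma polyintZ a b c p : a < b -> polyint a b (c *: p) = c * polyint a b p.
Proof.
move=> ab; have [P <-] := antiderivative p.
by rewrite -derivZ !polyint_deriv // !hornerZ mulrBr.
Qed.

Lemma polyintB a b p q : a < b ->
  polyint a b (p - q) = polyint a b p - polyint a b q.
Proof. by move=> ab; rewrite polyintD // -scaleN1r polyintZ // mulN1r. Qed.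

Lemma polyint_sum a b (I : finType) (p : I -> {poly R}) : a < b ->
  polyint a b (\sum_i p i) = \sum_i polyint a b (p i).
Proof.
move=> ab; apply: (big_morph (polyint a b)) => [x y|]; first exact: polyintD.
by rewrite -(scale0r 0) polyintZ // mul0r.
Qed.

Lemma polyint_by_parts a b p q : a < b ->
  polyint a b (p^`() * q) =
  p.[b] * q.[b] - p.[a] * q.[a] - polyint a b (p * q^`()).
Proof.
move=> ab.
have -> : p^`() * q = (p * q)^`() - p * q^`() by rewrite derivM addrK.
by rewrite polyintB // polyint_deriv // !hornerM.
Qed.

Definition cell_poly a b : {poly R} := ((b - a) / 2) *: 'X + ((a + b) / 2)%:P.

Lemma to_cell1 a b : to_cell a b 1 = b.
Proof. by rewrite /to_cell; lra. Qed.

Lemma to_cellN1 a b : to_cell a b (-1) = a.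
Proof. by rewrite /to_cell; lra. Qed.

Lemma to_cell_ref (x : R) : to_cell (-1) 1 x = x.
Proof. by rewrite /to_cell; lra. Qed.

Lemma horner_cell_poly a b x : (cell_poly a b).[x] = to_cell a b x.
Proof. by rewrite /cell_poly !hornerE /to_cell; lra. Qed.

Lemma deriv_cell_poly a b : (cell_poly a b)^`() = ((b - a) / 2)%:P.
Proof. by rewrite /cell_poly derivD derivZ derivX derivC addr0 alg_polyC. Qed.

Lemma size_cell_poly a b : a < b -> size (cell_poly a b) = 2.
Proof.
move=> ab; have h : (b - a) / 2 != 0 by apply/eqP; lra.
have sX : size (((b - a) / 2) *: 'X : {poly R}) = 2.
  by rewrite size_scale ?size_polyX.
by rewrite /cell_poly size_polyDl sX // size_polyC; case: (_ != 0).
Qed.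

Lemma polyint_cell a b p : a < b ->
  polyint a b p = (b - a) / 2 * polyint (-1) 1 (p \Po cell_poly a b).
Proof.
move=> ab; have ltN11 : -1 < 1 :> R by lra.
have [P <-] := antiderivative p.
rewrite -polyintZ // -mul_polyC mulrC -deriv_cell_poly -deriv_comp.
rewrite !polyint_deriv //.
by rewrite !horner_comp !horner_cell_poly to_cell1 to_cellN1.
Qed.

End Integral.

(** * Multiplicity of roots and derivatives *)

Section Multiplicity.
Variable R : realType.
Implicit Types (c : R) (p q : {poly R}).

Lemma deriv_mul_XsubCX c m q : (q * ('X - c%:P) ^+ m.+1)^`() =
  (q^`() * ('X - c%:P) + q *+ m.+1) * ('X - c%:P) ^+ m.
Proof.
rewrite derivM deriv_exp derivXsubC mul1r /= exprS [RHS]mulrDl mulrA.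
by rewrite mulrnAr mulrnAl.
Qed.

Lemma derivn_dvdp_XsubC c m p j : ('X - c%:P) ^+ m %| p -> (j < m)%N ->
  p^`(j).[c] = 0.
Proof.
move=> /dvdpP[q ->]; elim: j m q => [|j IH] [|m] q // jm.
  by rewrite derivn0 hornerM horner_exp hornerXsubC subrr expr0n mulr0.
by rewrite derivSn deriv_mul_XsubCX; exact: IH.
Qed.

(** Characteristic zero matters here: if [p = q (X-c)^(n+1)] with [q(c) != 0],
    cofactor [(n+1) q + q' (X-c)] of the derivative must not vanish at [c]. *)
Lemma dvdp_XsubC_derivn c m p :
  (forall j, (j < m)%N -> p^`(j).[c] = 0) -> ('X - c%:P) ^+ m %| p.
Proof.
elim: m p => [|m IH] p hp; first by rewrite expr0 dvd1p.
have [q [n [pE]]]: exists q n,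
    p = q * ('X - c%:P) ^+ n /\ (p != 0 -> ~~ root q c).
  by have [n [q /implyP ? ?]] := multiplicity_XsubC p c; exists q, n.
have [->|p0 /(_ isT) qc] := eqVneq p 0; first by rewrite dvdp0.
rewrite pE; apply: dvdp_mull; rewrite dvdp_Pexp2l ?size_XsubC //.
case: n pE => [|n] pE.
  move: (hp 0%N isT) qc; rewrite derivn0 pE expr0 mulr1 /root => ->.
  by rewrite eqxx.
have /IH : forall j, (j < m)%N -> p^`()^`(j).[c] = 0.
  by move=> j jm; rewrite -derivSn hp.
rewrite pE deriv_mul_XsubCX Gauss_dvdpr.
  by rewrite dvdp_Pexp2l ?size_XsubC.
rewrite coprimep_expl // coprimep_sym coprimep_XsubC /root.
by rewrite hornerD hornerM hornerXsubC subrr mulr0 add0r hornerMn mulrn_eq0.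
Qed.

End Multiplicity.

(** * The node polynomial *)

Section Nodes.
Variables (R : realType) (r k : nat).
Hypothesis hkr : (k <= r)%N.
Variable th : 'I_(r - k) -> R.
Hypothesis hth : quad_nodes th.
Implicit Types (a b c : R) (p q : {poly R}).

(** The monic polynomial of degree [r+1] all of whose Hermite interpolation data
    on the cell vanish; on the reference cell it is, up to a constant factor, the
    Jacobi weight times the Jacobi polynomial of degree [r-k]. *)
Definition node_poly a b : {poly R} :=
  ('X - a%:P) ^+ uphalf k * ('X - b%:P) ^+ k./2.+1 *
  \prod_i ('X - (to_cell a b (th i))%:P).

Lemma node_poly_monic a b : node_poly a b \is monic.
Proof.
by rewrite /node_poly !monicMr ?monic_exp ?monicXsubC ?monic_prod // => i _;
  exact: monicXsubC.
Qed.

Lemma size_node_poly a b : size (node_poly a b) = r.+2.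
Proof.
rewrite /node_poly size_Mmonic ?monic_neq0 ?monic_prod ?monicMr ?monic_exp
  ?monicXsubC //; last by move=> i _; exact: monicXsubC.
rewrite size_Mmonic ?monic_neq0 ?monic_exp ?monicXsubC //.
rewrite !size_exp_XsubC size_prod_XsubC -[index_enum _]enumT size_enum_ord /=.
have := odd_double_half k; rewrite uphalf_half -addnn => e.
lia.
Qed.

(** Each of the [r+1] linear factors picks up the factor [(b-a)/2]. *)
Lemma node_poly_comp a b :
  node_poly a b \Po cell_poly a b = ((b - a) / 2) ^+ r.+1 *: node_poly (-1) 1.
Proof.
have XC x : ('X - (to_cell a b x)%:P) \Po cell_poly a b =
    ((b - a) / 2) *: ('X - x%:P).
  rewrite comp_polyB comp_polyX comp_polyC /cell_poly scalerBr -addrA.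
  congr (_ + _).
  rewrite -polyCB -mul_polyC -polyCM -polyCN; congr (_%:P).
  by rewrite /to_cell; lra.
have XN := XC (-1); have X1 := XC 1; rewrite to_cellN1 to_cell1 in XN X1.
move: ((b - a) / 2) XC XN X1 => h XC XN X1.
have XE n p : (p \Po cell_poly a b) ^+ n = (p ^+ n) \Po cell_poly a b.
  by rewrite rmorphXn.
rewrite /node_poly !comp_polyM -!XE XN X1 !exprZn rmorph_prod /=.
under eq_bigr do rewrite XC.
rewrite scaler_prod big_const_ord iter_mulr_1.
under [in RHS]eq_bigr do rewrite to_cell_ref.
rewrite -!(scalerAl, scalerAr) !scalerA -!exprD; congr (_ ^+ _ *: _).
have := odd_double_half k; rewrite uphalf_half -addnn => e.
lia.
Qed.

Lemma node_poly_right a b : (node_poly a b).[b] = 0.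
Proof.
rewrite /node_poly !hornerM !horner_exp !hornerXsubC subrr exprS.
by rewrite !mul0r mulr0 mul0r.
Qed.

Lemma node_poly_left a b : (0 < k)%N -> (node_poly a b).[a] = 0.
Proof.
move=> k0; rewrite /node_poly !hornerM !horner_exp !hornerXsubC subrr.
rewrite (_ : uphalf k = (uphalf k).-1.+1) ?exprS ?mul0r //.
by case: (k) k0 => [|[]].
Qed.

Lemma derivn_node_poly_right a b j :
  (j <= k./2)%N -> (node_poly a b)^`(j).[b] = 0.
Proof.
move=> jk; apply: (@derivn_dvdp_XsubC _ _ k./2.+1) => //.
by rewrite /node_poly mulrAC dvdp_mull.
Qed.

Lemma derivn_node_poly_left a b j :
  (j < uphalf k)%N -> (node_poly a b)^`(j).[a] = 0.
Proof.
move=> jk; apply: (@derivn_dvdp_XsubC _ _ (uphalf k)) => //.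
by rewrite /node_poly -mulrA dvdp_mulr.
Qed.

Lemma node_poly_node a b i : (node_poly a b).[to_cell a b (th i)] = 0.
Proof.
rewrite /node_poly hornerM horner_prod (bigD1 i) //= hornerXsubC subrr.
by rewrite mul0r mulr0.
Qed.

(** The three factors of the node polynomial are pairwise coprime because the
    inner nodes lie strictly between the end points, and the last one splits into
    distinct linear factors. *)
Lemma node_poly_dvdp p :
  (forall j, (j < uphalf k)%N -> p^`(j).[-1] = 0) ->
  (forall j, (j <= k./2)%N -> p^`(j).[1] = 0) ->
  (forall i, p.[th i] = 0) -> node_poly (-1) 1 %| p.
Proof.
move=> hl hr hi; have [thI th1 _] := hth; rewrite /node_poly.
under eq_bigr do rewrite to_cell_ref.
have rootP c : root (\prod_i ('X - (th i)%:P)) c -> exists i, c = th i.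
  rewrite /root horner_prod prodf_seq_eq0 => /hasP[i _ /=].
  by rewrite hornerXsubC subr_eq0 => /eqP ->; exists i.
have cop c n : (forall i, c <> th i) ->
    coprimep (('X - c%:P) ^+ n) (\prod_i ('X - (th i)%:P)).
  move=> hc; apply: coprimep_expl; rewrite coprimep_sym coprimep_XsubC.
  by apply/negP => /rootP[i /hc].
rewrite Gauss_dvdp.
  rewrite Gauss_dvdp.
    rewrite !dvdp_XsubC_derivn //=.
    rewrite -(big_map th predT (fun c => 'X - c%:P)).
    apply: uniq_roots_dvdp.
      by apply/allP => _ /mapP[i _ ->]; rewrite /root hi.
    by rewrite uniq_rootsE map_inj_uniq // index_enum_uniq.
  apply: coprimep_expl; apply: coprimep_expr; apply: coprimep_XsubC2.
  by apply/eqP; lra.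
rewrite coprimepMl !cop // => i e; have := th1 i; rewrite -e ?ltxx ?andbF //.
Qed.

(** The node polynomial is the Jacobi weight times the Jacobi polynomial up to a
    constant, so this is the defining orthogonality of the latter. *)
Lemma node_poly_orthogonal_ref q : (size q <= r - k)%N ->
  polyint (-1) 1 (node_poly (-1) 1 * q) = 0.
Proof.
move=> sq; have [thI _ [p [sp pO] pR]] := hth.
have pE : p = lead_coef p *: \prod_i ('X - (th i)%:P).
  rewrite -(big_map th predT (fun c => 'X - c%:P)); apply: all_roots_prod_XsubC.
  - by rewrite sp size_map -[index_enum _]enumT size_enum_ord.
  - by apply/allP => _ /mapP[i _ ->]; apply/pR; exists i.
  - by rewrite uniq_rootsE map_inj_uniq // index_enum_uniq.
have lp : lead_coef p != 0 by rewrite lead_coef_eq0 -size_poly_gt0 sp.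
have ltN11 : -1 < 1 :> R by lra.
(* The weight contains powers of [1 - X], the node polynomial powers of
   [X - 1]; [p] need not be monic. *)
pose c := (-1) ^+ k./2.+1 * (lead_coef p)^-1.
have -> : node_poly (-1) 1 * q =
    c *: ((1 + 'X) ^+ uphalf k * (1 - 'X) ^+ k./2.+1 * p * q).
  rewrite [in RHS]pE /node_poly; under eq_bigr do rewrite to_cell_ref.
  rewrite -!(scalerAl, scalerAr) scalerA /c divfK //.
  have -> : 'X - (-1)%:P = 1 + 'X :> {poly R} by rewrite polyCN opprK addrC.
  have -> : 'X - 1%:P = (-1) *: (1 - 'X) :> {poly R} by rewrite scaleN1r opprB.
  by rewrite exprZn -!(scalerAl, scalerAr).
rewrite polyintZ //.
have [P PE] :=
  antiderivative ((1 + 'X) ^+ uphalf k * (1 - 'X) ^+ k./2.+1 * p * q).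
rewrite -PE polyint_deriv // -Rintegral_deriv_cc // PE.
apply/eqP; rewrite mulf_eq0; apply/orP; right; apply/eqP.
rewrite -[RHS](pO q sq); apply: eq_Rintegral => x _.
by rewrite !hornerM !horner_exp !hornerE.
Qed.

Lemma node_poly_orthogonal a b q : a < b -> (size q <= r - k)%N ->
  polyint a b (node_poly a b * q) = 0.
Proof.
move=> ab sq; rewrite polyint_cell // comp_polyM node_poly_comp.
rewrite -(scalerAl _ (node_poly _ _)).
have ltN11 : -1 < 1 :> R by lra.
rewrite polyintZ // node_poly_orthogonal_ref ?mulr0 //.
by rewrite size_comp_poly2 // size_cell_poly.
Qed.

End Nodes.

(** * Exactness of the interpolatory quadrature on polynomials *)

Section OneSided.
Variable R : realType.
Implicit Types (c : R) (p q : {poly R}).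

Lemma derive1n_horner j p : derive1n j (horner p) = horner p^`(j).
Proof. by elim: j => [|j IH] //=; rewrite IH -derivE. Qed.

Lemma lderiv_horner j p c : lderiv j (horner p) c = p^`(j).[c].
Proof.
rewrite /lderiv derive1n_horner; apply/cvg_lim; first exact: norm_hausdorff.
by apply: cvg_at_left_filter; exact: continuous_horner.
Qed.

Lemma rderiv_horner j p c : rderiv j (horner p) c = p^`(j).[c].
Proof.
rewrite /rderiv derive1n_horner; apply/cvg_lim; first exact: norm_hausdorff.
by apply: cvg_at_right_filter; exact: continuous_horner.
Qed.

End OneSided.

Section Exactness.
Variables (R : realType) (r k : nat).
Hypothesis hkr : (k <= r)%N.
Variable th : 'I_(r - k) -> R.
Hypothesis hth : quad_nodes th.
Implicit Types (a b c : R) (p q : {poly R}).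

Lemma is_hermite_horner p q : is_hermite th (horner q) p <->
  (size p <= r.+1)%N /\ node_poly th (-1) 1 %| q - p.
Proof.
split=> [[sp hl hr hi]|[sp dp]].
  split=> //; apply: node_poly_dvdp => // [j jk|j jk|i].
  - by rewrite derivnB hornerD hornerN hl // rderiv_horner subrr.
  - by rewrite derivnB hornerD hornerN hr // lderiv_horner subrr.
  - by rewrite hornerD hornerN hi subrr.
have {dp} [g /eqP] := dvdpP _ _ dp.
rewrite subr_eq addrC => /eqP ->; split=> // [j jk|j jk|i].
- rewrite rderiv_horner derivnD hornerD [X in _ + X](_ : _ = 0) ?addr0 //.
  apply: derivn_dvdp_XsubC jk.
  by rewrite /node_poly; apply: dvdp_mull; rewrite -mulrA; apply: dvdp_mulr.
- rewrite lderiv_horner derivnD hornerD [X in _ + X](_ : _ = 0) ?addr0 //.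
  apply: (@derivn_dvdp_XsubC _ _ k./2.+1) => //.
  by rewrite /node_poly; apply: dvdp_mull; rewrite mulrAC; apply: dvdp_mull.
- rewrite hornerD hornerM -[X in (node_poly _ _ _).[X]]to_cell_ref.
  by rewrite node_poly_node mulr0 addr0.
Qed.

(** The remainder of the division by the node polynomial is an interpolant, so
    the chosen one is a genuine interpolant; its error is [w g] with
    [deg g <= (2r-k) - (r+1) < r-k], which orthogonality kills. *)
Lemma polyint_hermite q : (size q <= (2 * r - k).+1)%N ->
  polyint (-1) 1 (hermite th (horner q)) = polyint (-1) 1 q.
Proof.
move=> sq; have ltN11 : -1 < 1 :> R by lra.
have ne0 : node_poly th (-1) 1 != 0 by rewrite -size_poly_gt0 size_node_poly.
have hH : is_hermite th (horner q) (hermite th (horner q)).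
  apply: (@xgetPex _ 0 [set p | is_hermite th (horner q) p]).
  exists (q %% node_poly th (-1) 1); apply/is_hermite_horner; split.
    by have := ltn_modp q (node_poly th (-1) 1); rewrite ne0 size_node_poly.
  by rewrite {1}(divp_eq q (node_poly th (-1) 1)) addrK dvdp_mull.
have [sp dvd] := (is_hermite_horner _ _).1 hH.
apply/eqP; rewrite eq_sym -subr_eq0 -polyintB // -(divpK dvd) mulrC.
rewrite node_poly_orthogonal // size_divp // size_node_poly //.
rewrite /= leq_subLR (_ : (r.+1 + (r - k))%N = (2 * r - k).+1); last lia.
rewrite (leq_trans (size_polyD _ _)) // size_polyN geq_max sq /=.
by apply: leq_trans sp _; lia.
Qed.

End Exactness.

(** * Functions with the same one-sided jet *)

Lemma is_derive_scale (R : realType) (V : normedModType R) (p : R -> R)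
    (f : R -> V) (x : R) :
  derivable p x 1 -> derivable f x 1 ->
  is_derive x 1 (fun y => p y *: f y) (derive1 p x *: f x + p x *: derive1 f x).
Proof.
move=> dp df; rewrite !derive1E.
have H : (fun h => h^-1 *: (p (h *: 1 + x) *: f (h *: 1 + x) - p x *: f x))
    @ 0^' --> 'D_1 p x *: f x + p x *: 'D_1 f x.
  have -> : (fun h =>
      h^-1 *: (p (h *: 1 + x) *: f (h *: 1 + x) - p x *: f x)) =
    (fun h => (h^-1 *: (p (h *: 1 + x) - p x)) *: f x +
              p (h *: 1 + x) *: (h^-1 *: (f (h *: 1 + x) - f x))).
    apply/funext => h; set y := h *: 1 + x.
    have -> : (h^-1 *: (p y - p x)) *: f x = h^-1 *: ((p y - p x) *: f x).
      by rewrite scalerA.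
    rewrite [p y *: (_ *: _)]scalerA mulrC -scalerA -scalerDr scalerBl.
    by congr (_ *: _); rewrite scalerBr [RHS]addrC addrA subrK.
  apply: cvgD; first by apply: cvgZ; [exact: dp | exact: cvg_cst].
  apply: cvgZ; last exact: df.
  have /differentiable_continuous cp : differentiable p x.
    exact/derivable1_diffP.
  have : (h *: 1 + x) @[h --> 0^'] --> x.
    rewrite -[X in _ --> X]add0r; apply: cvgD; last exact: cvg_cst.
    rewrite -[X in _ --> X](scale0r (1 : R^o)).
    by apply: cvgZ; [exact: nbhs_dnbhs | exact: cvg_cst].
  by move=> hx; apply: (cvg_comp _ _ hx).
split; first by apply/cvg_ex; eexists; exact: H.
exact: cvg_lim H.
Qed.

Section Jets.
Variables (R : realType) (a b : R) (Fl : set_system R).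
Context {FF : ProperFilter Fl}.
Hypothesis Fab : Fl `]a, b[%classic.

(** Both functions are [m] times differentiable on the open cell, and their
    derivatives of order at most [m] have common limits along the filter, which
    stands for a one-sided neighbourhood of an end point.  As a relation between
    two functions, equality of jets is stable under sums, products and chain rule
    by plain inductions, with no Leibniz or Faa di Bruno formula for the
    limits. *)
Fixpoint same_jet (V : normedModType R) (m : nat) (f g : R -> V) : Prop :=
  (exists l : V, f @ Fl --> l /\ g @ Fl --> l) /\
  match m with
  | 0%N => True
  | m'.+1 =>
      (forall x, x \in `]a, b[ -> derivable f x 1 /\ derivable g x 1) /\
      same_jet m' (derive1 f) (derive1 g)
  end.

Lemma near_cell x : x \in `]a, b[ -> \near x, x \in `]a, b[.
Proof. by move=> xab; apply: near_in_itvoo. Qed.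

Lemma eq_derive1 (V : normedModType R) (f g : R -> V) :
  {in `]a, b[, f =1 g} -> {in `]a, b[, derive1 f =1 derive1 g}.
Proof.
move=> fg x xab; rewrite !derive1E; apply: near_eq_derive.
by near=> y; apply: fg; near: y; exact: near_cell.
Unshelve. all: by end_near. Qed.

Lemma eq_derivable (V : normedModType R) (f g : R -> V) x :
  {in `]a, b[, f =1 g} -> x \in `]a, b[ -> derivable f x 1 -> derivable g x 1.
Proof.
move=> fg xab; apply: near_eq_derivable.
by near=> y; apply: fg; near: y; exact: near_cell.
Unshelve. all: by end_near. Qed.

Lemma eq_cvg_cell (V : normedModType R) (f g : R -> V) (l : V) :
  {in `]a, b[, f =1 g} -> f @ Fl --> l -> g @ Fl --> l.
Proof.
move=> fg; apply: cvg_trans; apply: near_eq_cvg.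
by apply: filterS Fab => x /= xab; exact: fg.
Qed.

Lemma eq_same_jet (V : normedModType R) m (f g f' g' : R -> V) :
  {in `]a, b[, f =1 f'} -> {in `]a, b[, g =1 g'} ->
  same_jet m f g -> same_jet m f' g'.
Proof.
elim: m f g f' g' => [|m IH] f g f' g' ff' gg' [[l [fl gl]] H].
  split=> //; exists l.
  by split; [exact: eq_cvg_cell fl | exact: eq_cvg_cell gl].
split; first exists l.
  by split; [exact: eq_cvg_cell fl | exact: eq_cvg_cell gl].
case: H => dfg H; split=> [x xab|].
  have [df dg] := dfg x xab.
  by split; [exact: eq_derivable df | exact: eq_derivable dg].
by apply: IH H; exact: eq_derive1.
Qed.

Section Vector.
Variable V : normedModType R.
Implicit Types f g h : R -> V.

Lemma same_jetW m m' f g : (m' <= m)%N -> same_jet m f g -> same_jet m' f g.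
Proof.
elim: m m' f g => [|m IH] [|m'] f g //= mm' [H]; first by move=> _; split.
by case=> D J; split=> //; split=> //; exact: IH J.
Qed.

Lemma same_jet_trans m f g h :
  same_jet m f g -> same_jet m g h -> same_jet m f h.
Proof.
elim: m f g h => [|m IH] f g h /= [[l [fl gl]] H] [[l' [gl' hl']] H'].
  split=> //; exists l; split=> //.
  by rewrite (cvg_unique _ gl gl').
split; first by exists l; split=> //; rewrite (cvg_unique _ gl gl').
case: H H' => D J [D' J']; split=> [x xab|]; last exact: IH J J'.
by split; [have [] := D x xab | have [] := D' x xab].
Qed.

Lemma same_jet_cvg m j f g : same_jet m f g -> (j <= m)%N ->
  exists l : V, derive1n j f @ Fl --> l /\ derive1n j g @ Fl --> l.
Proof.
elim: m j f g => [|m IH] [|j] f g //= [H]; try by [].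
by case=> _ J jm; have [l] := IH j _ _ J jm; rewrite -!derive1Sn; exists l.
Qed.

Lemma same_jet_lim m j f g : same_jet m f g -> (j <= m)%N ->
  lim (derive1n j f @ Fl) = lim (derive1n j g @ Fl).
Proof.
move=> H jm; have [l [fl gl]] := same_jet_cvg H jm.
by rewrite (cvg_lim _ fl) ?(cvg_lim _ gl).
Qed.

Lemma same_jet_of_lim m f g : same_jet m f f -> same_jet m g g ->
  (forall j, (j <= m)%N -> lim (derive1n j f @ Fl) = lim (derive1n j g @ Fl)) ->
  same_jet m f g.
Proof.
elim: m f g => [|m IH] f g /= [[l [fl _]] Hf] [[l' [gl _]] Hg] H.
  split=> //; exists l; split=> //; have /= := H 0%N isT.
  by rewrite (cvg_lim _ fl) ?(cvg_lim _ gl) // => ->.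
split.
  exists l; split=> //; have /= := H 0%N isT.
  by rewrite (cvg_lim _ fl) ?(cvg_lim _ gl) // => ->.
case: Hf Hg => Df Jf [Dg Jg]; split=> [x xab|].
  by split; [have [] := Df x xab | have [] := Dg x xab].
by apply: IH => // j jm; have := H j.+1 jm; rewrite !derive1Sn.
Qed.

Lemma same_jetD m f g f' g' : same_jet m f g -> same_jet m f' g' ->
  same_jet m (f \+ f') (g \+ g').
Proof.
elim: m f g f' g' => [|m IH] f g f' g' [[l [fl gl]] H] [[l' [fl' gl']] H'].
  by split=> //; exists (l + l'); split; apply: cvgD.
split; first by exists (l + l'); split; apply: cvgD.
case: H H' => D J [D' J']; split=> [x xab|].
  have [df dg] := D x xab; have [df' dg'] := D' x xab.
  by split; apply: derivableD.
have := IH _ _ _ _ J J'; apply: eq_same_jet => x xab /=;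
  have [df dg] := D x xab; have [df' dg'] := D' x xab;
  by rewrite !derive1E [RHS]deriveD.
Qed.

Lemma same_jet_cst m (v : V) : same_jet m (cst v) (cst v).
Proof.
elim: m v => [|m IH] v; first by split=> //; exists v; split; exact: cvg_cst.
split; first by exists v; split; exact: cvg_cst.
split=> [x xab|]; first by split; exact: derivable_cst.
have -> : derive1 (cst v) = cst (0 : V); last exact: IH.
by apply/funext => x; rewrite derive1_cst.
Qed.

Lemma same_jet_sum m (I : finType) (f g : I -> R -> V) :
  (forall i, same_jet m (f i) (g i)) ->
  same_jet m (fun x => \sum_i f i x) (fun x => \sum_i g i x).
Proof.
move=> H; elim: (index_enum I) => [|i s IH].
  by have := same_jet_cst m 0; apply: eq_same_jet => x _; rewrite big_nil.
by have := same_jetD (H i) IH; apply: eq_same_jet => x _; rewrite big_cons.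
Qed.

End Vector.

Lemma same_jetZ (V : normedModType R) m (p q : R -> R)
    (f g : R -> V) :
  same_jet m p q -> same_jet m f g ->
  same_jet m (fun x => p x *: f x) (fun x => q x *: g x).
Proof.
elim: m p q f g => [|m IH] p q f g.
  move=> [[k [pk qk]] _] [[l [fl gl]] _].
  by split=> //; exists (k *: l); split; apply: cvgZ.
move=> Hp Hf; have Wp := same_jetW (leqnSn m) Hp.
have Wf := same_jetW (leqnSn m) Hf.
case: Hp Hf => [[k [pk qk]] [D J]] [[l [fl gl]] [D' J']].
split; first by exists (k *: l); split; apply: cvgZ.
split=> [x xab|].
  have [dp dq] := D x xab; have [df dg] := D' x xab.
  by split; [have [] := is_derive_scale dp df
            | have [] := is_derive_scale dq dg].
have := same_jetD (IH _ _ _ _ J Wf) (IH _ _ _ _ Wp J').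
apply: eq_same_jet => x xab /=;
  have [dp dq] := D x xab; have [df dg] := D' x xab; rewrite [RHS]derive1E.
  by have [_ ->] := is_derive_scale dp df.
by have [_ ->] := is_derive_scale dq dg.
Qed.

Lemma same_jet_linear (V W : normedModType R) (L : {linear V -> W}) m
    (f g : R -> V) :
  continuous L -> same_jet m f g -> same_jet m (L \o f) (L \o g).
Proof.
move=> cL; have dL (h : R -> V) x : derivable h x 1 ->
    is_derive x 1 (L \o h) (L (derive1 h x)).
  move=> dh; rewrite derive1E.
  have dLh : (fun e => e^-1 *: (L (h (e *: 1 + x)) - L (h x))) @ 0^' -->
      L ('D_1 h x).
    have -> : (fun e => e^-1 *: (L (h (e *: 1 + x)) - L (h x))) =
        L \o (fun e => e^-1 *: (h (e *: 1 + x) - h x)).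
      by apply/funext => e; rewrite /= [RHS]linearZZ [in RHS]linearB.
    by apply: cvg_comp; [exact: dh | exact: cL].
  split; first by apply/cvg_ex; eexists; exact: dLh.
  exact: cvg_lim dLh.
have cvgL (h : R -> V) l : h @ Fl --> l -> L \o h @ Fl --> L l.
  by move=> hl; apply: cvg_comp; [exact: hl | exact: cL].
elim: m f g => [|m IH] f g [[l [fl gl]] H].
  by split=> //; exists (L l); split; exact: cvgL.
split; first by exists (L l); split; exact: cvgL.
case: H => D J; split=> [x xab|].
  have [df dg] := D x xab.
  by split; [have [] := dL _ _ df | have [] := dL _ _ dg].
have := IH _ _ J; apply: eq_same_jet => x xab; have [df dg] := D x xab.
  by rewrite [RHS]derive1E; have [_ ->] := dL _ _ df.
by rewrite [RHS]derive1E; have [_ ->] := dL _ _ dg.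
Qed.

Lemma same_jet_horner m c (p q : {poly R}) : id @ Fl --> c ->
  (forall j, (j <= m)%N -> p^`(j).[c] = q^`(j).[c]) ->
  same_jet m (horner p : R -> R) (horner q : R -> R).
Proof.
move=> Fc; have cvgh (u : {poly R}) : horner u @ Fl --> u.[c].
  by apply: (cvg_comp _ _ Fc); exact: continuous_horner.
elim: m p q => [|m IH] p q H.
  split=> //; exists p.[c]; split; first exact: cvgh.
  by rewrite (H 0%N isT); exact: cvgh.
split.
  exists p.[c]; split; first exact: cvgh.
  by rewrite (H 0%N isT); exact: cvgh.
split=> [x _|]; first by split; exact: derivable_horner.
rewrite -!derivE; apply: IH => j jm.
by rewrite -!derivSn H.
Qed.

End Jets.

(** * Polynomial curves, and smooth maps along them *)

Section PolyCurves.
Variables (R : realType) (d : nat).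
Implicit Types (P Q : 'I_d -> {poly R}).

Definition polyvec P (t : R) : 'cV[R]_d := \col_i (P i).[t].

Lemma derivable_polyvec P x : derivable (polyvec P) x 1.
Proof.
apply/derivable_mxP => i j.
have -> : (fun t => polyvec P t i j) = horner (P i).
  by apply/funext => t; rewrite mxE.
exact: derivable_horner.
Qed.

Lemma derive1_polyvec P : derive1 (polyvec P) = polyvec (fun i => (P i)^`()).
Proof.
apply/funext => x; rewrite derive1E derive_mx; last exact: derivable_polyvec.
apply/matrixP => i j; rewrite !mxE.
have -> : (fun t => polyvec P t i j) = horner (P i).
  by apply/funext => t; rewrite mxE.
by rewrite -derive1E -derivE.
Qed.

Lemma derive1n_polyvec n P :
  derive1n n (polyvec P) = polyvec (fun i => (P i)^`(n)).
Proof.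
elim: n => [|n IH]; first by [].
by rewrite derive1nS IH derive1_polyvec; congr polyvec; apply/funext => i.
Qed.

Lemma continuous_polyvec P : continuous (polyvec P).
Proof.
move=> x; apply/differentiable_continuous/derivable1_diffP.
exact: derivable_polyvec.
Qed.

Lemma rderiv_polyvec n P c :
  rderiv n (polyvec P) c = polyvec (fun i => (P i)^`(n)) c.
Proof.
rewrite /rderiv derive1n_polyvec; apply/cvg_lim; first exact: norm_hausdorff.
by apply: cvg_at_right_filter; exact: continuous_polyvec.
Qed.

End PolyCurves.

Section JetComposition.
Variables (R : realType) (a b c : R) (Fl : set_system R).
Context {FF : ProperFilter Fl}.
Hypothesis Fab : Fl `]a, b[%classic.
Hypothesis Fc : id @ Fl --> c.

Lemma cvg_strip d (t0 t1 : R) (G : R * 'cV[R]_d -> 'cV[R]_d)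
    (P : 'I_d -> {poly R}) :
  t0 <= a -> b <= t1 -> t0 <= c <= t1 ->
  {within [set z | t0 <= z.1 <= t1], continuous G} ->
  (fun t => G (t, polyvec P t)) @ Fl --> G (c, polyvec P c).
Proof.
move=> t0a bt1 ct /subspace_continuousP cG.
pose h t := (t, polyvec P t).
suff hc : h @ Fl --> within [set z | t0 <= z.1 <= t1] (nbhs (c, polyvec P c)).
  by apply: (cvg_comp _ _ hc); exact: cG.
have hn : h @ Fl --> (c, polyvec P c).
  apply: (@cvg_pair _ _ _ _ (nbhs c) (nbhs (polyvec P c)) _ _ _ id (polyvec P)).
    exact: Fc.
  apply: (@cvg_comp _ _ _ id (polyvec P) _ (nbhs c) _ Fc).
  exact: continuous_polyvec.
move=> U hU.
have hU' : \forall t \near Fl, t0 <= (h t).1 <= t1 -> U (h t) := hn _ hU.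
apply: filterS2 Fab hU' => t /=; rewrite in_itv /= => /andP[at_ tb]; apply.
by rewrite (le_trans t0a (ltW at_)) (le_trans (ltW tb) bt1).
Qed.

(** The tangent vector [(1, P')] is expanded in the standard basis, so that only
    directional derivatives along fixed vectors occur. *)
Lemma is_derive_along d (G : R * 'cV[R]_d -> 'cV[R]_d)
    (P : 'I_d -> {poly R}) x :
  differentiable G (x, polyvec P x) ->
  is_derive x 1 (fun t => G (t, polyvec P t))
    ('D_(1, 0) G (x, polyvec P x) +
     \sum_l (P l)^`().[x] *: 'D_(0, delta_mx l ord0) G (x, polyvec P x)).
Proof.
move=> dG; pose h t := (t, polyvec P t).
have dP : differentiable (polyvec P) x.
  by apply/derivable1_diffP; exact: derivable_polyvec.
have dh : differentiable h x by apply: differentiable_pair.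
have dGh : differentiable (G \o h) x by apply: differentiable_comp.
split; first exact: diff_derivable.
rewrite deriveE // diff_comp //= diff_pair //= -!deriveE // derive_id.
rewrite -derive1E derive1_polyvec.
have -> : (1, polyvec (fun l => (P l)^`()) x) =
    (1, 0) + \sum_l (P l)^`().[x] *: (0, delta_mx l ord0) :> R * 'cV[R]_d.
  have -> : \sum_l (P l)^`().[x] *: (0, delta_mx l ord0) =
      (0, \sum_l (P l)^`().[x] *: delta_mx l ord0) :> R * 'cV[R]_d.
    elim/big_rec2: _ => [//|l u v _ ->].
    by apply: injective_projections; rewrite /= ?scaler0 ?addr0.
  apply: injective_projections; rewrite /= ?addr0 ?add0r //.
  rewrite [LHS]matrix_sum_delta; apply: eq_bigr => l _.
  by rewrite big_ord1 mxE.
rewrite [LHS]deriveE // linearD linear_sum deriveE //; congr (_ + _).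
apply: eq_bigr => l _.
by rewrite linearZ deriveE.
Qed.

(** By the chain rule the derivative of [G(t, P(t))] is a combination of maps
    [H(t, P(t))] of the same kind, of smoothness one less, with coefficients the
    derivatives of [P]; the induction is on the order of the jet. *)
Lemma same_jet_Cstrip d (t0 t1 : R) m i (G : R * 'cV[R]_d -> 'cV[R]_d)
    (P Q : 'I_d -> {poly R}) :
  t0 <= a -> b <= t1 -> t0 <= c <= t1 -> (i <= m)%N -> Cstrip t0 t1 m G ->
  (forall l j, (j <= i)%N -> (P l)^`(j).[c] = (Q l)^`(j).[c]) ->
  same_jet a b Fl i (fun t => G (t, polyvec P t)) (fun t => G (t, polyvec Q t)).
Proof.
move=> t0a bt1 ct.
have lims (G0 : R * 'cV[R]_d -> 'cV[R]_d) (P0 Q0 : 'I_d -> {poly R}) :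
    {within [set z | t0 <= z.1 <= t1], continuous G0} ->
    (forall l, (P0 l).[c] = (Q0 l).[c]) ->
    exists l : 'cV[R]_d, (fun t => G0 (t, polyvec P0 t)) @ Fl --> l /\
      (fun t => G0 (t, polyvec Q0 t)) @ Fl --> l.
  move=> cG PQ; exists (G0 (c, polyvec P0 c)); split.
    exact: cvg_strip t0a bt1 ct cG.
  have -> : polyvec P0 c = polyvec Q0 c; last exact: cvg_strip t0a bt1 ct cG.
  by apply/colP => l; rewrite !mxE.
elim: i m G P Q => [|i IH] m G P Q im CG PQ.
  have cG : {within [set z | t0 <= z.1 <= t1], continuous G}.
    by case: m im CG => [|m] _ [].
  by split=> //; apply: lims => // l; exact: (PQ l 0%N).
case: m im CG => [//|m] im [cG [dG HG]].
have xt x : x \in `]a, b[ -> t0 < x < t1.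
  rewrite in_itv /= => /andP[ax xb].
  by rewrite (le_lt_trans t0a ax) (lt_le_trans xb bt1).
have {HG} /choice[H HH] : forall v, exists H, Cstrip t0 t1 m H /\
    forall z : R * 'cV[R]_d, t0 < z.1 < t1 -> 'D_v G z = H z.
  by move=> v; have [H ? ?] := HG v; exists H.
have dGP (S : 'I_d -> {poly R}) x : x \in `]a, b[ ->
    is_derive x 1 (fun t => G (t, polyvec S t)) (H (1, 0) (x, polyvec S x) +
      \sum_l (S l)^`().[x] *: H (0, delta_mx l ord0) (x, polyvec S x)).
  move=> /xt xt01; have := is_derive_along (dG (x, polyvec S x) xt01).
  rewrite (HH (1, 0)).2 //; congr (is_derive _ _ _ (_ + _)).
  by apply: eq_bigr => l _; rewrite (HH _).2.
split; first by apply: lims => // l; exact: (PQ l 0%N).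
split=> [x xab|].
  by split; [have [] := dGP P x xab | have [] := dGP Q x xab].
have IHv v : same_jet a b Fl i (fun t => H v (t, polyvec P t))
                               (fun t => H v (t, polyvec Q t)).
  apply: (IH m) => //; first exact: (HH v).1.
  by move=> l j ji; apply: PQ; exact: leqW.
have J l : same_jet a b Fl i
    (fun t => (P l)^`().[t] *: H (0, delta_mx l ord0) (t, polyvec P t))
    (fun t => (Q l)^`().[t] *: H (0, delta_mx l ord0) (t, polyvec Q t)).
  apply: same_jetZ => //; apply: same_jet_horner Fc _ => j ji.
  by rewrite -!derivSn PQ.
apply: eq_same_jet (same_jetD _ (IHv (1, 0)) (same_jet_sum _ J)) => // x xab.
- by rewrite [RHS]derive1E; have [_ ->] := dGP P x xab.
- by rewrite [RHS]derive1E; have [_ ->] := dGP Q x xab.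
Qed.

End JetComposition.

(** * From the reference cell to a cell *)

Section OneSidedFilters.
Variables (R : realType) (a b : R).

Lemma at_left_cell : a < b -> at_left b `]a, b[%classic.
Proof.
by move=> ab; near=> t; rewrite /= in_itv /=; apply/andP; split.
Unshelve. all: by end_near. Qed.

Lemma at_right_cell : a < b -> at_right a `]a, b[%classic.
Proof.
by move=> ab; near=> t; rewrite /= in_itv /=; apply/andP; split.
Unshelve. all: by end_near. Qed.

Lemma at_left_id : id @ at_left b --> b.
Proof. by apply: cvg_at_left_filter; exact: cvg_id. Qed.

Lemma at_right_id : id @ at_right a --> a.
Proof. by apply: cvg_at_right_filter; exact: cvg_id. Qed.

End OneSidedFilters.

Section Cells.
Variables (R : realType) (a b : R).
Hypothesis ab : a < b.

Lemma in_oo_oc t : t \in `]a, b[ -> t \in `]a, b].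
Proof. by rewrite !in_itv /= => /andP[-> /ltW ->]. Qed.

Lemma to_cell_in (x : R) : -1 < x < 1 -> to_cell a b x \in `]a, b[.
Proof.
rewrite in_itv /= /to_cell => /andP[x1 x2].
have ba0 : 0 < b - a by rewrite subr_gt0.
have h1 : 0 < (b - a) * (x + 1) by apply: mulr_gt0 => //; lra.
have h2 : 0 < (b - a) * (1 - x) by apply: mulr_gt0 => //; lra.
by apply/andP; split; lra.
Qed.

Lemma continuous_to_cell : continuous (to_cell a b).
Proof.
have -> : to_cell a b = horner (cell_poly a b).
  by apply/funext => y; rewrite horner_cell_poly.
exact: continuous_horner.
Qed.

Lemma to_cell_at_left : to_cell a b @ at_left 1 --> at_left b.
Proof.
move=> U hU.
have H : \forall x \near (1 : R), to_cell a b x < b -> U (to_cell a b x).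
  have := @continuous_to_cell 1.
  by rewrite /continuous_at to_cell1 => /(_ _ hU).
apply: filterS H => x /= + x1; apply.
have ba0 : 0 < b - a by rewrite subr_gt0.
have h2 : 0 < (b - a) * (1 - x) by apply: mulr_gt0 => //; lra.
by rewrite /to_cell; lra.
Qed.

Lemma to_cell_at_right : to_cell a b @ at_right (-1) --> at_right a.
Proof.
move=> U hU.
have H : \forall x \near (-1 : R), a < to_cell a b x -> U (to_cell a b x).
  have := @continuous_to_cell (-1).
  by rewrite /continuous_at to_cellN1 => /(_ _ hU).
apply: filterS H => x /= + x1; apply.
have ba0 : 0 < b - a by rewrite subr_gt0.
have h1 : 0 < (b - a) * (x + 1) by apply: mulr_gt0 => //; lra.
by rewrite /to_cell; lra.
Qed.

Lemma is_derive_cell (f : R -> R) x : derivable f (to_cell a b x) 1 ->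
  is_derive x 1 (f \o to_cell a b) ((b - a) / 2 * derive1 f (to_cell a b x)).
Proof.
move=> df; have -> : to_cell a b = horner (cell_poly a b).
  by apply/funext => y; rewrite horner_cell_poly.
rewrite mulrC (_ : (b - a) / 2 = (cell_poly a b)^`().[x]); last first.
  by rewrite deriv_cell_poly hornerC.
apply: is_derive1_comp; rewrite horner_cell_poly derive1E.
exact: derivableP.
Qed.

Lemma same_jet_cell (Fl Fr : set_system R) {FF : ProperFilter Fl}
    {FF' : ProperFilter Fr} m (f g : R -> R) :
  Fl `]a, b[%classic -> Fr `](-1), 1[%classic ->
  to_cell a b @ Fr --> Fl ->
  same_jet a b Fl m f g ->
  same_jet (-1) 1 Fr m (f \o to_cell a b) (g \o to_cell a b).
Proof.
move=> Fab Fr11 FT; elim: m f g => [|m IH] f g [[l [fl gl]] H].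
  by split=> //; exists l; split; apply: (cvg_comp _ _ FT).
split; first by exists l; split; apply: (cvg_comp _ _ FT).
case: H => D J; split=> [x|].
  rewrite in_itv => /to_cell_in xab; have [df dg] := D _ xab.
  by split; [have [] := is_derive_cell df | have [] := is_derive_cell dg].
apply: (eq_same_jet Fr11 _ _ (same_jetZ Fr11
  (same_jet_cst (-1) 1 m ((b - a) / 2)) (IH _ _ J))) => x;
  rewrite in_itv => /to_cell_in xab; have [df dg] := D _ xab.
  by rewrite [RHS]derive1E; have [_ ->] := is_derive_cell df.
by rewrite [RHS]derive1E; have [_ ->] := is_derive_cell dg.
Qed.

Lemma eq_lim_cell (V : normedModType R) (Fl : set_system R)
    {FF : ProperFilter Fl} n (f g : R -> V) :
  Fl `]a, b[%classic -> {in `]a, b[, f =1 g} ->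
  lim (derive1n n f @ Fl) = lim (derive1n n g @ Fl).
Proof.
move=> Fab fg; have {fg} : {in `]a, b[, derive1n n f =1 derive1n n g}.
  by elim: n => [//|n IH]; exact: eq_derive1.
move=> fg; congr lim; rewrite eqEsubset; split; apply: near_eq_cvg.
  by apply: filterS Fab => x /= xab; rewrite fg.
by apply: filterS Fab => x /= xab; rewrite fg.
Qed.

Section PolynomialOnCell.
Variables (d : nat) (X : R -> 'cV[R]_d) (S : 'I_d -> {poly R}).
Hypothesis XS : {in `]a, b], X =1 polyvec S}.

Lemma cvg_cell_left : X x @[x --> b^'-] --> polyvec S b.
Proof.
apply: (eq_cvg_cell (at_left_cell ab) (f := polyvec S)).
  by move=> t tab; rewrite XS // in_oo_oc.
by apply: cvg_at_left_filter; exact: continuous_polyvec.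
Qed.

Lemma lderiv0_cell : lderiv 0 X b = polyvec S b.
Proof. by apply/cvg_lim; [exact: norm_hausdorff | exact: cvg_cell_left]. Qed.

Lemma rderiv0_cell : rderiv 0 X a = polyvec S a.
Proof.
rewrite -[RHS](rderiv_polyvec 0) /rderiv.
apply: eq_lim_cell; first exact: (at_right_cell ab).
by move=> t tab; rewrite XS // in_oo_oc.
Qed.

Lemma derive1_cell t : t \in `]a, b[ ->
  derive1 X t = polyvec (fun i => (S i)^`()) t.
Proof.
move=> tab; rewrite -derive1_polyvec; apply: eq_derive1 tab => x xab.
by apply: XS; exact: in_oo_oc.
Qed.

End PolynomialOnCell.

Section Quad.
Variables (r k : nat) (th : 'I_(r - k) -> R).
Hypotheses (hkr : (k <= r)%N) (hth : quad_nodes th).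

Lemma eq_hermite (f g : R -> R) :
  (forall j, (j < uphalf k)%N -> rderiv j f (-1) = rderiv j g (-1)) ->
  (forall j, (j <= k./2)%N -> lderiv j f 1 = lderiv j g 1) ->
  (forall i, f (th i) = g (th i)) -> hermite th f = hermite th g.
Proof.
move=> hl hr hi; congr xget; apply/predeqP => p.
by split=> -[? Hl Hr Hi]; split=> // *; rewrite ?Hl ?Hr ?Hi ?hl ?hr ?hi.
Qed.

(** The rule only sees the interpolation data of the integrand, so a function
    with the same data as a polynomial of degree at most [2r-k] is integrated
    like this polynomial.  For [k = 0] there are no data at the left end point. *)
Lemma quad_exact (f : R -> R) (q : {poly R}) :
  (size q <= (2 * r - k).+1)%N ->
  same_jet a b (at_left b) k./2 f (horner q) ->
  ((0 < k)%N -> same_jet a b (at_right a) (uphalf k).-1 f (horner q)) ->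
  (forall i, f (to_cell a b (th i)) = q.[to_cell a b (th i)]) ->
  quad th a b f = polyint a b q.
Proof.
move=> sq Jr Jl Hi; rewrite /quad /interp.
have qT : horner (q \Po cell_poly a b) = horner q \o to_cell a b.
  by apply/funext => x; rewrite horner_comp horner_cell_poly.
have ltN11 : -1 < 1 :> R by lra.
rewrite (@eq_hermite _ (horner (q \Po cell_poly a b))).
- rewrite -/(polyint a b _) polyint_cell // -comp_polyA.
  have -> : ((2 / (b - a)) *: 'X - ((a + b) / (b - a))%:P) \Po cell_poly a b
      = 'X.
    have ba0 : b - a != 0 by rewrite subr_eq0 gt_eqF.
    have E1 : 2 / (b - a) * ((b - a) / 2) = 1 by field.
    have E2 : 2 / (b - a) * ((a + b) / 2) = (a + b) / (b - a) by field.
    rewrite comp_polyB comp_polyZ comp_polyX comp_polyC /cell_poly scalerDr.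
    by rewrite scalerA E1 scale1r -[_ *: _%:P]mul_polyC -polyCM E2 addrK.
  rewrite comp_polyXr polyint_hermite //; last first.
    by rewrite size_comp_poly2 ?size_cell_poly.
  by rewrite [RHS]polyint_cell.
- move=> j jk; rewrite qT.
  have k0 : (0 < k)%N by case: (k) jk.
  apply: same_jet_lim (same_jet_cell (at_right_cell ab) (at_right_cell ltN11)
    to_cell_at_right (Jl k0)) _.
  by rewrite -ltnS prednK // (leq_ltn_trans _ jk).
- move=> j jk; rewrite qT.
  exact: same_jet_lim (same_jet_cell (at_left_cell ab) (at_left_cell ltN11)
    to_cell_at_left Jr) jk.
- by move=> i; rewrite /= qT /= Hi.
Qed.

End Quad.
End Cells.

(** * The interpolant of a collocation solution on one cell *)

Section CellLemma.
Variables (R : realType) (d r k : nat).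
Hypothesis hkr : (k <= r)%N.
Variable th : 'I_(r - k) -> R.
Hypothesis hth : quad_nodes th.
Variables (M : 'M[R]_d) (F : R -> 'cV[R]_d -> 'cV[R]_d) (t0 t1 : R).
Hypothesis hF : Cstrip t0 t1 k./2 (fun z => F z.1 z.2).
Variables (a b : R).
Hypotheses (ab : a < b) (t0a : t0 <= a) (bt1 : b <= t1).
Implicit Types (P Q : 'I_d -> {poly R}).

Definition mulmx_poly P : 'I_d -> {poly R} := fun i => \sum_j M i j *: P j.

Lemma mulmx_polyvec P t : M *m polyvec P t = polyvec (mulmx_poly P) t.
Proof.
apply/colP => i; rewrite !mxE horner_sum; apply: eq_bigr => j _.
by rewrite hornerZ mxE.
Qed.

Lemma derivn_mulmx_poly n P :
  (fun i => (mulmx_poly P i)^`(n)) = mulmx_poly (fun i => (P i)^`(n)).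
Proof.
apply/funext => i; rewrite /mulmx_poly (big_morph _ (derivnD n) (linear0 _)).
by apply: eq_bigr => j _; rewrite derivnZ.
Qed.

Definition dot_poly P Q : {poly R} := \sum_i P i * Q i.

Lemma dotp_polyvec P Q t :
  dotp (polyvec P t) (polyvec Q t) = (dot_poly P Q).[t].
Proof.
rewrite /dotp horner_sum; apply: eq_bigr => i _.
by rewrite !mxE hornerM.
Qed.

Lemma same_jet_dotp (Fl : set_system R) {FF : ProperFilter Fl} (c : R) m
    (X Y : R -> 'cV[R]_d) P : Fl `]a, b[%classic -> id @ Fl --> c ->
  same_jet a b Fl m X Y ->
  same_jet a b Fl m (fun t => dotp (X t) (polyvec P t))
                    (fun t => dotp (Y t) (polyvec P t)).
Proof.
move=> Fab Fc J; apply: same_jet_sum => // i.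
pose L := fun x : 'cV[R]_d => x i ord0.
have lL : linear L by move=> u x y; rewrite /L !mxE.
pose LL := GRing.isLinear.Build _ _ _ _ _ lL.
pose Ll : {linear 'cV[R]_d -> R} := HB.pack L LL.
have J1 : same_jet a b Fl m (Ll \o X) (Ll \o Y).
  by apply: same_jet_linear J => //; exact: coord_continuous.
have J2 : same_jet a b Fl m (horner (P i)) (horner (P i)).
  exact: same_jet_horner Fc _.
by apply: eq_same_jet (same_jetZ Fab J1 J2) => // t _ /=; rewrite mxE.
Qed.

Lemma same_jet_polyvec (Fl : set_system R) {FF : ProperFilter Fl} (c : R) m P :
  Fl `]a, b[%classic -> id @ Fl --> c ->
  same_jet a b Fl m (polyvec P) (polyvec P).
Proof.
move=> Fab Fc; have cP S : polyvec S @ Fl --> polyvec S c.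
  apply: (@cvg_comp _ _ _ id (polyvec _) _ (nbhs c) _ Fc).
  exact: continuous_polyvec.
elim: m P => [|m IH] P.
  by split=> //; exists (polyvec P c); split; exact: cP.
split; first by exists (polyvec P c); split; exact: cP.
split=> [x _|]; first by split; exact: derivable_polyvec.
by rewrite derive1_polyvec; exact: IH.
Qed.

Variables (V W : R -> 'cV[R]_d) (P : 'I_d -> {poly R}).
Hypothesis sP : forall i, (size (P i) <= r.+2)%N.

(** The Hermite interpolant of [P] on the cell: subtracting a multiple of the
    node polynomial leaves the interpolation data unchanged, and the node
    polynomial is monic of degree [r+1]. *)
Definition interpolant : 'I_d -> {poly R} :=
  fun i => P i - (P i)`_r.+1 *: node_poly th a b.

Notation Q := interpolant.

Lemma size_interpolant i : (size (Q i) <= r.+1)%N.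
Proof.
have mon := @node_poly_monic R r k th a b.
apply/leq_sizeP => j; rewrite leq_eqVlt => /predU1P[<-|rj].
  move: mon; rewrite monicE lead_coefE size_node_poly // => /eqP E.
  by rewrite /Q coefB coefZ E mulr1 subrr.
rewrite /Q coefB coefZ nth_default ?(leq_trans (sP i)) //.
by rewrite [(node_poly _ _ _)`_j]nth_default ?size_node_poly // mulr0 subrr.
Qed.

Hypothesis VP : {in `]a, b], V =1 polyvec P}.
Hypothesis WQ : {in `]a, b], W =1 polyvec Q}.

(** An end point [c] of the cell with its one-sided filter; [m] is one less than
    the number of interpolation conditions at [c]. *)
Section End.
Variables (Fl : set_system R) (c : R) (m : nat).
Context {FF : ProperFilter Fl}.
Hypotheses (Fab : Fl `]a, b[%classic) (Fc : id @ Fl --> c).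
Hypotheses (acb : a <= c <= b) (mk : (m <= k./2)%N).
Hypothesis Qc : forall j, (j <= m)%N -> (node_poly th a b)^`(j).[c] = 0.
Hypothesis colloc : forall j, (j <= m)%N ->
  M *m lim (derive1n j.+1 V @ Fl) = lim (derive1n j (fun t => F t (V t)) @ Fl).

Lemma lim_polyvec n S : lim (derive1n n (polyvec S) @ Fl) =
  polyvec (fun i => (S i)^`(n)) c :> 'cV[R]_d.
Proof.
rewrite derive1n_polyvec; apply/cvg_lim; first exact: norm_hausdorff.
apply: (@cvg_comp _ _ _ id (polyvec _) _ (nbhs c) _ Fc).
exact: continuous_polyvec.
Qed.

Lemma derivn_interpolant i j : (j <= m)%N -> (Q i)^`(j).[c] = (P i)^`(j).[c].
Proof.
move=> jm; rewrite /Q derivnB derivnZ hornerD hornerN hornerZ Qc //.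
by rewrite mulr0 subr0.
Qed.

(** The data of [F(t, W(t))] are those of [F(t, V(t))], which by collocation are
    those of [M V']. *)
Lemma same_jet_rhs :
  same_jet a b Fl m (fun t => F t (W t))
    (polyvec (mulmx_poly (fun i => (P i)^`()))).
Proof.
have ct : t0 <= c <= t1.
  by case/andP: acb => ac cb; rewrite (le_trans t0a ac) (le_trans cb bt1).
pose G z := F z.1 z.2.
have JG S S' : (forall i j, (j <= m)%N -> (S i)^`(j).[c] = (S' i)^`(j).[c]) ->
    same_jet a b Fl m (fun t => G (t, polyvec S t))
                      (fun t => G (t, polyvec S' t)).
  by move=> H; apply: (same_jet_Cstrip Fab Fc t0a bt1 ct mk hF).
have JP : same_jet a b Fl m (fun t => G (t, polyvec P t))
    (polyvec (mulmx_poly (fun i => (P i)^`()))).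
  apply: same_jet_of_lim => //; first exact: JG.
    exact: same_jet_polyvec Fc.
  move=> j jm.
  rewrite -(eq_lim_cell _ (f := fun t => F t (V t)) Fab) //; last first.
    by move=> t /in_oo_oc tab; rewrite VP.
  rewrite -colloc // (eq_lim_cell _ (g := polyvec P) Fab) //; last first.
    by move=> t /in_oo_oc tab; rewrite VP.
  rewrite !lim_polyvec mulmx_polyvec derivn_mulmx_poly.
  by congr (polyvec (mulmx_poly _) _); apply/funext => i; rewrite derivSn.
apply: eq_same_jet (same_jet_trans (JG Q P _) JP) => //.
  by move=> t /in_oo_oc tab; rewrite /G /= WQ.
by move=> i j jm; exact: derivn_interpolant.
Qed.

(** One condition at [c] is lost in comparison with collocation, since the
    derivative of order [i+1] of [W] agrees with that of [V] only for
    [i+1 <= m]. *)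
Lemma lim_vtd_condition i : (i < m)%N ->
  M *m lim (derive1n i.+1 W @ Fl) = lim (derive1n i (fun t => F t (W t)) @ Fl).
Proof.
move=> im; rewrite (same_jet_lim same_jet_rhs (ltnW im)).
rewrite (eq_lim_cell _ (g := polyvec Q) Fab) //; last first.
  by move=> t /in_oo_oc tab; rewrite WQ.
rewrite !lim_polyvec derivn_mulmx_poly -mulmx_polyvec; congr (M *m _).
by apply/colP => l; rewrite !mxE derivn_interpolant // -derivSn.
Qed.

End End.

Hypothesis col_r : forall i, (i <= k./2)%N ->
  M *m lderiv i.+1 V b = lderiv i (fun t => F t (V t)) b.
Hypothesis col_l : forall i, (i < uphalf k)%N ->
  M *m rderiv i.+1 V a = rderiv i (fun t => F t (V t)) a.
Hypothesis col_i : forall i : 'I_(r - k),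
  let t := to_cell a b (th i) in M *m derive1 V t = F t (V t).

Let leab : a <= b. Proof. exact: ltW. Qed.

Let uk : ((uphalf k).-1 <= k./2)%N.
Proof. by rewrite uphalf_half; case: (odd k) => //=; exact: leq_pred. Qed.

Let lt_uphalf j : (0 < k)%N -> (j <= (uphalf k).-1)%N -> (j < uphalf k)%N.
Proof. by move=> k0 h; rewrite -(@prednK (uphalf k)) //; case: (k) k0. Qed.

Lemma same_jet_rhs_right : same_jet a b (at_left b) k./2
  (fun t => F t (W t)) (polyvec (mulmx_poly (fun i => (P i)^`()))).
Proof.
apply: (same_jet_rhs (c := b)) => //.
- exact: at_left_cell.
- exact: at_left_id.
- by rewrite lexx leab.
- by move=> j jk; exact: derivn_node_poly_right.
Qed.

Lemma same_jet_rhs_left : (0 < k)%N -> same_jet a b (at_right a) (uphalf k).-1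
  (fun t => F t (W t)) (polyvec (mulmx_poly (fun i => (P i)^`()))).
Proof.
move=> k0.
apply: (same_jet_rhs (c := a)) => //.
- exact: at_right_cell.
- exact: at_right_id.
- by rewrite lexx leab.
- by move=> j /(lt_uphalf k0) jk; exact: derivn_node_poly_left.
- by move=> j /(lt_uphalf k0) jk; exact: col_l.
Qed.

Lemma cell_vtd_right i : (i < k./2)%N ->
  M *m lderiv i.+1 W b = lderiv i (fun t => F t (W t)) b.
Proof.
move=> ik; apply: (lim_vtd_condition (c := b)) ik => //.
- exact: at_left_cell.
- exact: at_left_id.
- by rewrite lexx leab.
- by move=> j jk; exact: derivn_node_poly_right.
Qed.

Lemma cell_vtd_left i : (i.+1 < uphalf k)%N ->
  M *m rderiv i.+1 W a = rderiv i (fun t => F t (W t)) a.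
Proof.
move=> ik; have k0 : (0 < k)%N by case: (k) ik.
apply: (lim_vtd_condition (c := a) (m := (uphalf k).-1)) => //.
- exact: at_right_cell.
- exact: at_right_id.
- by rewrite lexx leab.
- by move=> j /(lt_uphalf k0) jk; exact: derivn_node_poly_left.
- by move=> j /(lt_uphalf k0) jk; exact: col_l.
- by rewrite -ltnS prednK // (leq_ltn_trans _ ik).
Qed.

Lemma polyvec_interpolant_node i :
  polyvec Q (to_cell a b (th i)) = polyvec P (to_cell a b (th i)).
Proof.
apply/colP => l; rewrite !mxE hornerD hornerN hornerZ node_poly_node.
by rewrite mulr0 subr0.
Qed.

Lemma size_deriv_leq n (p : {poly R}) :
  (size p <= n.+1)%N -> (size p^`() <= n)%N.
Proof.
have [->|p0] := eqVneq p 0; first by rewrite deriv0 size_poly0.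
by move=> sp; rewrite -ltnS (leq_trans (lt_size_deriv p0)).
Qed.

Lemma size_dot_poly (S phi : 'I_d -> {poly R}) :
  (forall i, (size (S i) <= r.+1)%N) ->
  (forall i, (size (phi i) <= (r - k).+1)%N) ->
  (size (dot_poly (mulmx_poly S) phi) <= (2 * r - k).+1)%N.
Proof.
move=> sS sphi; rewrite (leq_trans (size_sum _ _ _)) //.
apply/bigmax_leqP => i _.
have sM : (size (mulmx_poly S i) <= r.+1)%N.
  rewrite (leq_trans (size_sum _ _ _)) //; apply/bigmax_leqP => j _.
  by rewrite (leq_trans (size_scale_leq _ _)).
apply: leq_trans (size_polyMleq _ _) _.
have := leq_add sM (sphi i); move: (size _) (size _) => u v h.
lia.
Qed.

Section Variational.
Variables (f : R -> 'cV[R]_d) (phi : 'I_d -> {poly R}).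
Hypothesis sphi : forall i, (size (phi i) <= (r - k).+1)%N.
Hypothesis fphi : {in `]a, b], f =1 polyvec phi}.

Lemma quad_rhs : quad th a b (fun t => dotp (F t (W t)) (f t)) =
  polyint a b (dot_poly (mulmx_poly (fun i => (P i)^`())) phi).
Proof.
apply: quad_exact => //.
- apply: size_dot_poly => // i; exact: size_deriv_leq.
- have J := same_jet_dotp phi (at_left_cell ab) (@at_left_id _ b)
    same_jet_rhs_right.
  apply: (eq_same_jet (at_left_cell ab) _ _ (J _)) => t.
    by move=> /in_oo_oc tab; rewrite fphi.
  by move=> tab; rewrite dotp_polyvec.
- move=> k0.
  have J := same_jet_dotp phi (at_right_cell ab) (@at_right_id _ a)
    (same_jet_rhs_left k0).
  apply: (eq_same_jet (at_right_cell ab) _ _ (J _)) => t.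
    by move=> /in_oo_oc tab; rewrite fphi.
  by move=> tab; rewrite dotp_polyvec.
- move=> i; have [_ /(_ i) /(to_cell_in ab) tab _] := hth.
  rewrite fphi ?in_oo_oc // WQ ?in_oo_oc // polyvec_interpolant_node.
  rewrite -VP ?in_oo_oc // -col_i (derive1_cell VP) // mulmx_polyvec.
  by rewrite dotp_polyvec.
Qed.

Lemma quad_lhs : quad th a b (fun t => dotp (M *m derive1 W t) (f t)) =
  polyint a b (dot_poly (mulmx_poly (fun i => (Q i)^`())) phi).
Proof.
have H t : t \in `]a, b[ -> dotp (M *m derive1 W t) (f t) =
    (dot_poly (mulmx_poly (fun i => (Q i)^`())) phi).[t].
  move=> tab; rewrite (derive1_cell WQ) // mulmx_polyvec fphi ?in_oo_oc //.
  by rewrite dotp_polyvec.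
have J (Fl : set_system R) (FF : ProperFilter Fl) (c : R) m :
    Fl `]a, b[%classic -> id @ Fl --> c ->
    same_jet a b Fl m (fun t => dotp (M *m derive1 W t) (f t))
      (horner (dot_poly (mulmx_poly (fun i => (Q i)^`())) phi)).
  move=> Fab Fc; set q := dot_poly _ _.
  have J : same_jet a b Fl m (horner q) (horner q).
    exact: same_jet_horner Fc _.
  by apply: (eq_same_jet Fab _ _ J) => // t tab; rewrite H.
apply: quad_exact => //.
- apply: size_dot_poly => // i; apply: size_deriv_leq.
  exact: leqW (size_interpolant i).
- by apply: J; [exact: at_left_cell | exact: at_left_id].
- by move=> _; apply: J; [exact: at_right_cell | exact: at_right_id].
- by move=> i; apply: H; have [_ /(_ i) /(to_cell_in ab)] := hth.
Qed.

(** Here [W] is compared with the limit of [V] at the left end point, which by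
    continuity of the collocation solution is the value [V(a^-) = W(a^-)] that
    enters the jump term. *)
Lemma cell_vtd_var :
  quad th a b (fun t => dotp (M *m derive1 W t) (f t))
  + (k == 0%N)%:R * dotp (M *m (rderiv 0 W a - rderiv 0 V a)) (rderiv 0 f a)
  = quad th a b (fun t => dotp (F t (W t)) (f t)).
Proof.
rewrite quad_lhs quad_rhs.
set w := node_poly th a b; set c := \col_i (P i)`_r.+1.
have mulPE i : mulmx_poly (fun i => (Q i)^`()) i =
    mulmx_poly (fun i => (P i)^`()) i - (M *m c) i ord0 *: w^`().
  rewrite /mulmx_poly mxE scaler_suml -sumrB; apply: eq_bigr => j _.
  by rewrite derivB derivZ scalerBr scalerA mxE.
have int_w i : polyint a b (w^`() * phi i) = - (w.[a] * (phi i).[a]).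
  rewrite polyint_by_parts // node_poly_right.
  rewrite node_poly_orthogonal // ?size_deriv_leq //.
  by rewrite mul0r subr0 sub0r.
have -> : polyint a b (dot_poly (mulmx_poly (fun i => (Q i)^`())) phi) =
    polyint a b (dot_poly (mulmx_poly (fun i => (P i)^`())) phi) +
    w.[a] * dotp (M *m c) (polyvec phi a).
  rewrite /dot_poly !polyint_sum // /dotp mulr_sumr -big_split.
  apply: eq_bigr => i _ /=; rewrite mulPE mulrBl polyintB // -scalerAl.
  by rewrite polyintZ // int_w mxE mxE; ring.
rewrite (rderiv0_cell ab WQ) (rderiv0_cell ab VP) (rderiv0_cell ab fphi).
have -> : polyvec Q a - polyvec P a = - w.[a] *: c.
  by apply/colP => i; rewrite !mxE hornerD hornerN hornerZ; ring.
have dZ e x y : dotp (e *: x) y = e * dotp x y :> R.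
  by rewrite /dotp mulr_sumr; apply: eq_bigr => i _; rewrite mxE mulrA.
rewrite -scalemxAr dZ.
(* For [k = 0] the boundary term cancels the jump; otherwise [w(a) = 0]. *)
have [k0|k0] := posnP k; first by rewrite mulr1n; ring.
by rewrite /w node_poly_left //; ring.
Qed.

End Variational.

End CellLemma.

(** * Assembling the cells of a mesh *)

Section MeshFacts.
Variables (R : realType) (t0 T : R) (m : mesh t0 T).

Lemma mesh_start : mt m 0%N = t0. Proof. by case: m. Qed.
Lemma mesh_end : mt m (mN m) = t0 + T. Proof. by case: m. Qed.
Lemma mesh_step n : (n < mN m)%N -> mt m n < mt m n.+1.
Proof. by case: m => N t e0 eN h; exact: h. Qed.

Lemma mesh_le i j : (i <= j)%N -> (j <= mN m)%N -> mt m i <= mt m j.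
Proof.
elim: j => [|j IH]; first by rewrite leqn0 => /eqP ->.
rewrite leq_eqVlt => /predU1P[-> //|]; rewrite ltnS => ij jN.
exact: le_trans (IH ij (ltnW jN)) (ltW (mesh_step jN)).
Qed.

Lemma mesh_ge_start n : (n <= mN m)%N -> t0 <= mt m n.
Proof. by move=> nN; rewrite -{1}mesh_start mesh_le. Qed.

Lemma mesh_le_end n : (n <= mN m)%N -> mt m n <= t0 + T.
Proof. by move=> nN; rewrite -mesh_end mesh_le. Qed.

Notation cell n := `]mt m n, mt m n.+1].

Lemma cell_sub n t : (n < mN m)%N -> t \in cell n -> t \in `]t0, t0 + T].
Proof.
move=> nN; rewrite !in_itv /= => /andP[h1 h2].
rewrite (le_lt_trans (mesh_ge_start (ltnW nN)) h1).
by rewrite (le_trans h2 (mesh_le_end nN)).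
Qed.

Lemma cell_inj i j t : (i < mN m)%N -> (j < mN m)%N ->
  t \in cell i -> t \in cell j -> i = j.
Proof.
move=> iN jN; rewrite !in_itv /= => /andP[i1 i2] /andP[j1 j2].
case: (ltngtP i j) => // ij.
  have := le_lt_trans i2 (le_lt_trans (mesh_le ij (ltnW jN)) j1).
  by rewrite ltxx.
have := le_lt_trans j2 (le_lt_trans (mesh_le ij (ltnW iN)) i1).
by rewrite ltxx.
Qed.

Lemma glue (V : zmodType) (S : nat -> R -> V) :
  exists W : R -> V, forall n, (n < mN m)%N -> {in cell n, W =1 S n}.
Proof.
exists (fun t => \sum_(i < mN m | t \in cell i) S i t) => n nN t tn.
rewrite (big_pred1 (Ordinal nN)) // => i; apply/idP/eqP => [ti|-> //].
by apply: val_inj; exact: cell_inj ti tn.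
Qed.

End MeshFacts.

Section Postprocess.
Variables (R : realType) (d r k : nat).
Hypothesis hkr : (k <= r)%N.
Variable th : 'I_(r - k) -> R.
Hypothesis hth : quad_nodes th.
Variables (M : 'M[R]_d) (F : R -> 'cV[R]_d -> 'cV[R]_d).
Variables (t0 T : R) (u0 : 'cV[R]_d).
Hypothesis hF : Cstrip t0 (t0 + T) k./2 (fun z => F z.1 z.2).
Variables (m : mesh t0 T) (V : R -> 'cV[R]_d).
Hypothesis colV : is_collocation th M F u0 m V.

(** The cellwise Hermite interpolant of a collocation solution solves the
    variational method and has the same left limits at the mesh points. *)
Lemma collocation_vtd : exists2 W, is_VTD th M F u0 m W &
  forall n, (n < mN m)%N -> exists2 l : 'cV[R]_d,
    V x @[x --> (mt m n.+1)^'-] --> l & W x @[x --> (mt m n.+1)^'-] --> l.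
Proof.
have /choice[P HP] : forall n, exists P : 'I_d -> {poly R}, (n < mN m)%N ->
    (forall i, (size (P i) <= r.+2)%N) /\
    {in `]mt m n, mt m n.+1], V =1 polyvec P}.
  move=> n; have [nN|nN] := boolP (n < mN m)%N; last by exists (fun=> 0).
  have [P sP VP] := col_space colV nN; exists P => _; split=> // t tn.
  by apply/colP => i; rewrite mxE -VP.
pose Q n := interpolant th (mt m n) (mt m n.+1) (P n).
have [W WQ] := glue m (fun n => polyvec (Q n)).
have Qr n : polyvec (Q n) (mt m n.+1) = polyvec (P n) (mt m n.+1).
  apply/colP => i; rewrite !mxE hornerD hornerN hornerZ node_poly_right.
  by rewrite mulr0 subr0.
have lvW n : (n <= mN m)%N -> lvalue u0 m W n = lvalue u0 m V n.
  case: n => [//|n] nN /=.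
  rewrite (lderiv0_cell (mesh_step nN) (WQ n nN)).
  by rewrite (lderiv0_cell (mesh_step nN) (HP n nN).2).
exists W; last first.
  move=> n nN; exists (polyvec (P n) (mt m n.+1)).
    exact: (cvg_cell_left (mesh_step nN) (HP n nN).2).
  by rewrite -Qr; exact: (cvg_cell_left (mesh_step nN) (WQ n nN)).
split.
- move=> n nN; exists (Q n) => [i|t tn i].
    exact: size_interpolant (HP n nN).1 i.
  by rewrite (WQ n nN) // mxE.
- move=> k0 n nN; rewrite lvW ?(ltnW nN) // -(col_cont colV nN).
  rewrite (rderiv0_cell (mesh_step nN) (WQ n nN)).
  rewrite (rderiv0_cell (mesh_step nN) (HP n nN).2).
  apply/colP => i; rewrite !mxE hornerD hornerN hornerZ node_poly_left //.
  by rewrite mulr0 subr0.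
- move=> n nN i ik; have [sP VP] := HP n nN.
  apply: (cell_vtd_right hF (mesh_step nN) _ _ VP (WQ n nN)) => //.
  + exact: mesh_ge_start (ltnW nN).
  + exact: mesh_le_end.
  + by move=> j jk; exact: (col_right colV).
- move=> n nN i ik; have [sP VP] := HP n nN.
  apply: (cell_vtd_left hF (mesh_step nN) _ _ VP (WQ n nN)) => //.
  + exact: mesh_ge_start (ltnW nN).
  + exact: mesh_le_end.
  + by move=> j jk; exact: (col_left colV).
- move=> n nN f [phi sphi fphi]; have [sP VP] := HP n nN.
  have fP : {in `]mt m n, mt m n.+1], f =1 polyvec phi}.
    by move=> t tn; apply/colP => i; rewrite mxE fphi.
  rewrite lvW ?(ltnW nN) // -(col_cont colV nN).
  apply: (cell_vtd_var hkr hth hF (mesh_step nN) _ _ sP VP (WQ n nN) _ _ _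
    sphi fP) => //.
  + exact: mesh_ge_start (ltnW nN).
  + exact: mesh_le_end.
  + by move=> j jk; exact: (col_right colV).
  + by move=> j jk; exact: (col_left colV).
  + by move=> i; exact: (col_inner colV).
Qed.

End Postprocess.

(** The nodal error is a limit of the difference [u - U]; it splits into the
    limits of the two terms only because [u] converges as well. *)
Lemma solution_left_cvg (R : realType) (d : nat) (M : 'M[R]_d)
    (F : R -> 'cV[R]_d -> 'cV[R]_d) (t0 T : R) (u0 : 'cV[R]_d)
    (u : R -> 'cV[R]_d) (t : R) :
  solves_ivp M F t0 T u0 u -> t \in `]t0, t0 + T] -> u x @[x --> t^'-] --> u t.
Proof.
move=> [_ /subspace_continuousP cu _]; rewrite in_itv /= => /andP[t0t tT].
apply: cvg_trans (cu t _); last by rewrite /= in_itv /= (ltW t0t) tT.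
move=> U hU.
have {}hU : \forall x \near t, x \in `[t0, t0 + T] -> U (u x) := hU.
have h : \forall x \near t, x < t -> U (u x).
  apply: filterS2 hU (lt_nbhsr t0t) => x /= Ux t0x xt; apply: Ux.
  by rewrite in_itv /= (ltW t0x) (le_trans (ltW xt)).
exact: h.
Qed.

Theorem corollary4p8 (R : realType) (d r k : nat) (hkr : (k <= r)%N)
    (th : 'I_(r - k) -> R) (hth : quad_nodes th)
    (M : 'M[R]_d) (hM : M \in unitmx)
    (t0 T : R) (hT : 0 < T) (u0 : 'cV[R]_d)
    (F : R -> 'cV[R]_d -> 'cV[R]_d)
    (hFsmooth : Cstrip t0 (t0 + T) k./2 (fun z => F z.1 z.2))
    (hFlip : lipschitz2 t0 (t0 + T) F)
    (u : R -> 'cV[R]_d) (hu : solves_ivp M F t0 T u0 u)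
    (meshes : set (mesh t0 T))
    (Ut : mesh t0 T -> R -> 'cV[R]_d)
    (hUt : forall m, meshes m ->
       is_the_solution t0 T (is_collocation th M F u0 m) (Ut m))
    (herr : exists C : R, forall m, meshes m ->
       nodal_error m u (Ut m) <= C * msize m ^+ (2 * r - k + 1))
    (U : mesh t0 T -> R -> 'cV[R]_d)
    (hU : forall m, meshes m ->
       is_the_solution t0 T (is_VTD th M F u0 m) (U m)) :
  exists C : R, forall m, meshes m ->
    nodal_error m u (U m) = nodal_error m u (Ut m) /\
    nodal_error m u (Ut m) <= C * msize m ^+ (2 * r - k + 1).
Proof.
have [C hC] := herr; exists C => m mm; split; last exact: hC.
have [colU _] := hUt m mm; have [_ uniqU] := hU m mm.
have [W vtdW lims] := collocation_vtd hkr hth hFsmooth colU.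
have WU := uniqU W vtdW.
apply: eq_bigr => -[n nN] _ /=; congr enorm.
have ab := mesh_step nN; have bI : mt m n.+1 \in `]t0, t0 + T].
  by apply: (cell_sub nN); rewrite in_itv /= ab lexx.
have [l Vl Wl] := lims n nN.
have ul := solution_left_cvg hu bI.
have Ul : U m x @[x --> (mt m n.+1)^'-] --> l.
  apply: (eq_cvg_cell (at_left_cell ab)) Wl => t tab.
  by rewrite WU // (cell_sub nN) // in_oo_oc.
have H (X : R -> 'cV[R]_d) : X x @[x --> (mt m n.+1)^'-] --> l ->
    lderiv 0 (u \- X) (mt m n.+1) = u (mt m n.+1) - l.
  by move=> Xl; apply/cvg_lim; [exact: norm_hausdorff | exact: cvgB].
by rewrite !H.
Qed.
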